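(* A super-intuitionistic logic has a weak excluded middle law (WEML) if and only if it extends $\mathbf{KC}$ (i.e., its theorems include $\neg v\vee\neg\neg v$).
   Context: A deductive system $\vdash$ over an algebraic signature (with an infinite set of variables and set of formulas $\mathit{Fm}$) is a finitary, substitution-invariant consequence relation from sets of formulas to formulas (reflexive and transitive in the usual sense). A super-intuitionistic logic is an axiomatic extension of intuitionistic propositional logic $\mathbf{IPC}$ (in the usual signature of $\wedge,\vee,\to,\neg$, with $\bot$), regarded as a deductive system: for a set of formulas $\mathbf{L}$ containing the theorems of $\mathbf{IPC}$ and closed under substitution and modus ponens, $\Gamma\vdash_{\mathbf{L}}\alpha$ iff $\alpha$ is derivable from $\Gamma\cup\mathbf{L}$ by modus ponens. $\mathbf{KC}$ is the extension of $\mathbf{IPC}$ by the axiom $\neg v\vee\neg\neg v$, where $v$ is a variable. Definition of WEML. $\Gamma\vdash\Pi$ means $\Gamma\vdash\alpha$ for all $\alpha\in\Pi$. Let $v_1,v_2,\dots$ be a fixed sequence of distinct variables, $\mathbb{N}^+=\{1,2,\dots\}$, and let $\mathit{Fm}(n)$ be the set of formulas whose variables are among $v_1,\dots,v_n$. For $\Psi\subseteq\mathit{Fm}(n)$, $\Psi(\alpha_1,\dots,\alpha_n)$ denotes the result of substituting $\alpha_i$ for $v_i$ in all members of $\Psi$. A set $\Xi$ of formulas is inconsistent in $\vdash$ if $\Xi\vdash\alpha$ for all $\alpha\in\mathit{Fm}$. An elementary IL-sequence for $\vdash$ is a family $\{\Psi_n:n\in\mathbb{N}^+\}$ of finite sets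 $\Psi_n\subseteq\mathit{Fm}(n)$ such that for all $n\in\mathbb{N}^+$ and all $\Gamma\cup\{\alpha_1,\dots,\alpha_n\}\subseteq\mathit{Fm}$: $\Gamma\cup\{\alpha_1,\dots,\alpha_n\}$ is inconsistent in $\vdash$ iff $\Gamma\vdash\Psi_n(\alpha_1,\dots,\alpha_n)$. Given such a sequence, let $\#n=|\Psi_n|$, $\Psi_n=\{\psi_n^1,\dots,\psi_n^{\#n}\}$ and $\Psi_{\#n}\Psi_n=\Psi_{\#n}(\psi_n^1,\dots,\psi_n^{\#n})\subseteq\mathit{Fm}(n)$ (the order of enumeration is immaterial up to interderivability). $\vdash$ has a WEML if it has an elementary IL-sequence $\{\Psi_n\}$ such that for all $n\in\mathbb{N}^+$ and all $\Gamma\cup\{\alpha_1,\dots,\alpha_n,\varphi\}\subseteq\mathit{Fm}$: if $\Gamma\cup\Psi_n(\alpha_1,\dots,\alpha_n)\vdash\varphi$ and $\Gamma\cup\Psi_{\#n}\Psi_n(\alpha_1,\dots,\alpha_n)\vdash\varphi$, then $\Gamma\vdash\varphi$. (If $\Psi_n=\emptyset$, this condition for $n$ is trivially true.) *)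

(* Defs.v *)
From HB Require Import structures.
From mathcomp Require Import all_boot.
From mathcomp Require Import classical_sets.

Set Implicit Arguments.
Unset Strict Implicit.
Unset Printing Implicit Defensive.

Local Open Scope classical_set_scope.

Inductive fm (V : Type) : Type :=
| Var of V
| Bot
| Neg of fm V
| And of fm V & fm V
| Or of fm V & fm V
| Imp of fm V & fm V.

Arguments Bot {V}.

Fixpoint fm_encode (V : Type) (a : fm V) : GenTree.tree V :=
  match a with
  | Var x => GenTree.Leaf x
  | Bot => GenTree.Node 0 [::]
  | Neg a => GenTree.Node 1 [:: fm_encode a]
  | And a b => GenTree.Node 2 [:: fm_encode a; fm_encode b]
  | Or a b => GenTree.Node 3 [:: fm_encode a; fm_encode b]
  | Imp a b => GenTree.Node 4 [:: fm_encode a; fm_encode b]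
  end.

Fixpoint fm_decode (V : Type) (t : GenTree.tree V) : fm V :=
  match t with
  | GenTree.Leaf x => Var x
  | GenTree.Node 1 [:: a] => Neg (fm_decode a)
  | GenTree.Node 2 [:: a; b] => And (fm_decode a) (fm_decode b)
  | GenTree.Node 3 [:: a; b] => Or (fm_decode a) (fm_decode b)
  | GenTree.Node 4 [:: a; b] => Imp (fm_decode a) (fm_decode b)
  | _ => Bot
  end.

Lemma fm_encodeK (V : Type) : cancel (@fm_encode V) (@fm_decode V).
Proof. by elim=> //= [a -> | a -> b -> | a -> b -> | a -> b ->]. Qed.

HB.instance Definition _ (V : eqType) :=
  Equality.copy (fm V) (can_type (@fm_encodeK V)).

Fixpoint subst (V : Type) (s : V -> fm V) (a : fm V) : fm V :=
  match a with
  | Var x => s x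
  | Bot => Bot
  | Neg a => Neg (subst s a)
  | And a b => And (subst s a) (subst s b)
  | Or a b => Or (subst s a) (subst s b)
  | Imp a b => Imp (subst s a) (subst s b)
  end.

Fixpoint vars (V : Type) (a : fm V) : seq V :=
  match a with
  | Var x => [:: x]
  | Bot => [::]
  | Neg a => vars a
  | And a b | Or a b | Imp a b => vars a ++ vars b
  end.

Inductive IPC (V : Type) : fm V -> Prop :=
| IPC_K a b : IPC (Imp a (Imp b a))
| IPC_S a b c :
    IPC (Imp (Imp a (Imp b c)) (Imp (Imp a b) (Imp a c)))
| IPC_andl a b : IPC (Imp (And a b) a)
| IPC_andr a b : IPC (Imp (And a b) b)
| IPC_and a b : IPC (Imp a (Imp b (And a b)))
| IPC_orl a b : IPC (Imp a (Or a b))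
| IPC_orr a b : IPC (Imp b (Or a b))
| IPC_or a b c : IPC (Imp (Imp a c) (Imp (Imp b c) (Imp (Or a b) c)))
| IPC_bot a : IPC (Imp Bot a)
| IPC_negE a : IPC (Imp (Neg a) (Imp a Bot))
| IPC_negI a : IPC (Imp (Imp a Bot) (Neg a))
| IPC_mp a b : IPC (Imp a b) -> IPC a -> IPC b.

Definition super_intuitionistic (V : Type) (L : set (fm V)) : Prop :=
  [/\ @IPC V `<=` L,
      forall (s : V -> fm V) a, L a -> L (subst s a)
    & forall a b, L (Imp a b) -> L a -> L b].

(* The deductive system of L. Substitution is not a rule here: it is only
   sound for theorems, not for hypotheses in G. *)
Inductive derivable (V : Type) (L G : set (fm V)) : fm V -> Prop :=
| derivable_ax a : L a -> derivable L G a
| derivable_hyp a : G a -> derivable L G a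
| derivable_mp a b :
    derivable L G (Imp a b) -> derivable L G a -> derivable L G b.

Definition wem (V : Type) (x : V) : fm V :=
  Or (Neg (Var x)) (Neg (Neg (Var x))).

Inductive KC (V : Type) (x : V) : fm V -> Prop :=
| KC_IPC a : IPC a -> KC x a
| KC_wem : KC x (wem x)
| KC_subst (s : V -> fm V) a : KC x a -> KC x (subst s a)
| KC_mp a b : KC x (Imp a b) -> KC x a -> KC x b.

Definition extends (V : Type) (D D' : set (fm V) -> fm V -> Prop) : Prop :=
  forall G a, D' G a -> D G a.

Section WEML.
Variables (V : eqType) (v : nat -> V) (D : set (fm V) -> fm V -> Prop).

Definition derives_all (G P : set (fm V)) : Prop := forall a, P a -> D G a.

Definition inconsistent (X : set (fm V)) : Prop := forall a, D X a.

(* The distinguished variables are numbered from 0: v i is the (i+1)-st one. *)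
Definition Fm_in (n : nat) (a : fm V) : Prop :=
  {subset vars a <= mkseq v n}.

(* s(a_1, ..., a_n), where n = size al; all other variables are fixed. *)
Definition inst (s al : seq (fm V)) : seq (fm V) :=
  [seq subst (fun x => nth (Var x) al (index x (mkseq v (size al)))) a
  | a <- s].

(* A finite set of formulas is given by a duplicate-free enumeration, so that
   its cardinality is the size of the sequence. Psi 0 is irrelevant. *)
Definition elementary_IL_sequence (Psi : nat -> seq (fm V)) : Prop :=
  forall n, 0 < n ->
  [/\ uniq (Psi n),
      forall a, a \in Psi n -> Fm_in n a
    & forall (G : set (fm V)) (al : n.-tuple (fm V)),
        inconsistent (G `|` [set` al]) <->
        derives_all G [set` inst (Psi n) al]].

Definition PsiPsi (Psi : nat -> seq (fm V)) (n : nat) : seq (fm V) :=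
  inst (Psi (size (Psi n))) (Psi n).

(* When Psi n is empty, PsiPsi Psi n involves the irrelevant Psi 0, but the
   condition then holds by its first premise alone. *)
Definition has_WEML : Prop :=
  exists2 Psi, elementary_IL_sequence Psi &
    forall n, 0 < n ->
    forall (G : set (fm V)) (al : n.-tuple (fm V)) (phi : fm V),
      D (G `|` [set` inst (Psi n) al]) phi ->
      D (G `|` [set` inst (PsiPsi Psi n) al]) phi ->
      D G phi.

End WEML.

(* Main.v *)
Require Import Defs.
From mathcomp Require Import all_boot.
From mathcomp Require Import classical_sets.

(** The negation of a finite conjunction of formulas expresses their joint
    inconsistency, by the deduction theorem; here it is written in the curried
    form a_1 -> (... -> (a_n -> Bot)).  The singletons consisting of this
    formula in v_1, ..., v_n therefore form an elementary IL-sequence for every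
    super-intuitionistic logic.  For it, a WEML is proof by cases on b and on
    b -> Bot, where b is the curried formula.  As b is equivalent to its own
    double negation, the instance ~ b \/ ~ ~ b of the axiom of KC supplies the
    two cases ([KC_has_WEML]).

    Conversely, let Psi be any elementary IL-sequence and take n = 1.  The
    defining property forces Psi_1(x) to be interderivable with ~ x, and the
    property for m = #|Psi_1| makes Psi_m(Psi_1(x)) inconsistent with Psi_1(x),
    hence with ~ x.  So Psi_1(x) proves ~ x, Psi_m(Psi_1(x)) proves ~ ~ x, each
    of them proves ~ x \/ ~ ~ x, and the WEML discharges both
    ([WEML_derives_wem]). *)

Set Implicit Arguments.
Unset Strict Implicit.
Unset Printing Implicit Defensive.

Local Open Scope classical_set_scope.

Section Derivability.
Variables (V : eqType) (L : set (fm V)).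
Hypothesis L_IPC : @IPC V `<=` L.
Implicit Types (G H : set (fm V)) (a b c : fm V) (s : seq (fm V)).

Lemma derivable_cut G H b :
  (forall a, G a -> derivable L H a) -> derivable L G b -> derivable L H b.
Proof.
move=> GH; elim=> [a La | a /GH // | a c _ IHac _ IHa].
- exact: derivable_ax.
- exact: derivable_mp IHac IHa.
Qed.

Lemma derivable_sub G H b : G `<=` H -> derivable L G b -> derivable L H b.
Proof. by move=> GH; apply: derivable_cut => a /GH; apply: derivable_hyp. Qed.

Lemma derivable_IPC G a : IPC a -> derivable L G a.
Proof. by move=> /L_IPC; apply: derivable_ax. Qed.

Lemma IPC_Imp_refl a : IPC (Imp a a).
Proof.
exact: IPC_mp (IPC_mp (IPC_S a (Imp a a) a) (IPC_K _ _)) (IPC_K _ _).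
Qed.

Lemma deduction1 G a b :
  derivable L (G `|` [set` [:: a]]) b <-> derivable L G (Imp a b).
Proof.
split=> [|Gab].
- elim=> [c Lc | c [Gc | /=] | c d _ IHcd _ IHc].
  + by apply: derivable_mp (derivable_ax _ Lc); apply/derivable_IPC/IPC_K.
  + by apply: derivable_mp (derivable_hyp _ Gc); apply/derivable_IPC/IPC_K.
  + by rewrite inE => /eqP ->; apply/derivable_IPC/IPC_Imp_refl.
  + apply: derivable_mp IHc; apply: derivable_mp IHcd.
    exact/derivable_IPC/IPC_S.
- apply: (@derivable_mp _ _ _ a).
  + by apply: derivable_sub Gab => c; left.
  + by apply: derivable_hyp; right; rewrite /= mem_head.
Qed.

Lemma deduction G s b :
  derivable L (G `|` [set` s]) b <-> derivable L G (foldr (@Imp V) b s).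
Proof.
elim: s G => [|a s IHs] G /=.
  split; last by apply: derivable_sub => c; left.
  by apply: derivable_sub => c [].
rewrite -deduction1 -IHs; split; apply: derivable_sub => c /=.
- case=> [Gc|]; first by left; left.
  by rewrite inE => /orP[/eqP -> | sc]; [left; right; exact: mem_head | right].
- case=> [[Gc|] | sc]; first by left.
  + by rewrite /= inE => /eqP ->; right; rewrite mem_head.
  + by right; rewrite inE sc orbT.
Qed.

Lemma derivable_Neg G a : derivable L G (Neg a) <-> derivable L G (Imp a Bot).
Proof.
by split; apply: derivable_mp; apply/derivable_IPC; constructor.
Qed.

Lemma derivable_orE G a b c :
  derivable L G (Or a b) ->
  derivable L (G `|` [set` [:: a]]) c -> derivable L (G `|` [set` [:: b]]) c ->
  derivable L G c.
Proof.
move=> Gab /deduction1 Gac /deduction1 Gbc.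
apply: derivable_mp Gab; apply: derivable_mp Gbc; apply: derivable_mp Gac.
exact/derivable_IPC/IPC_or.
Qed.

Lemma inconsistentE G : inconsistent (derivable L) G <-> derivable L G Bot.
Proof.
split=> [| GBot a]; first exact.
by apply: derivable_mp GBot; apply/derivable_IPC/IPC_bot.
Qed.

(** An iterated implication with conclusion [Bot] is a negated conjunction, and
    intuitionistic logic eliminates double negations of negated formulas. *)
Lemma foldr_Imp_Bot_regular G s :
  derivable L G (Neg (Neg (foldr (@Imp V) Bot s))) ->
  derivable L G (foldr (@Imp V) Bot s).
Proof.
set b := foldr _ _ _ => Gnnb; apply/deduction.
apply: (@derivable_mp _ _ _ (Neg b)).
- by apply/derivable_Neg; apply: derivable_sub Gnnb => c; left.
- apply/derivable_Neg/deduction1.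
  apply: (@derivable_sub ((G `|` [set` [:: b]]) `|` [set` s])).
    by move=> c [[Gc | bc] | sc]; [left; left | right | left; right].
  by apply/deduction/derivable_hyp; right; exact: mem_head.
Qed.

End Derivability.

Section Substitution.
Variables (V : eqType) (v : nat -> V).
Implicit Types (a : fm V) (s t al : seq (fm V)).

Lemma subst_comp (f g : V -> fm V) a :
  subst f (subst g a) = subst (fun y => subst f (g y)) a.
Proof. by elim: a => //= [a -> | a -> b -> | a -> b -> | a -> b ->]. Qed.

Lemma eq_in_subst (f g : V -> fm V) a :
  {in vars a, f =1 g} -> subst f a = subst g a.
Proof.
elim: a => //= [y fg | a IHa fg | a IHa b IHb fg | a IHa b IHb fg
              | a IHa b IHb fg].
- by apply: fg; rewrite mem_head.
- by rewrite IHa.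
all: by rewrite IHa ?IHb // => y y_in; apply: fg; rewrite mem_cat y_in ?orbT.
Qed.

(** A variable beyond the first [size t] is fixed by [inst v _ t] but not
    necessarily by [inst v _ al], hence the restriction on [s].  For
    [s = Psi m] and [t = Psi n] this turns the instances of [PsiPsi] into
    instances of [Psi m], to which the defining property of an elementary
    IL-sequence applies. *)
Lemma inst_inst s t al :
  (forall a, a \in s -> Fm_in v (size t) a) ->
  inst v (inst v s t) al = inst v s (inst v t al).
Proof.
move=> s_t; rewrite /inst -map_comp; apply/eq_in_map => a /s_t a_t /=.
rewrite subst_comp size_map; apply: eq_in_subst => y /a_t.
by rewrite -index_mem size_mkseq => y_t; rewrite (nth_map (Var y)).
Qed.

Lemma subst_foldr_Imp (f : V -> fm V) b s :
  subst f (foldr (@Imp V) b s) =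
  foldr (@Imp V) (subst f b) [seq subst f a | a <- s].
Proof. by elim: s => //= a s ->. Qed.

Lemma vars_foldr_Imp b s :
  vars (foldr (@Imp V) b s) = flatten [seq vars a | a <- s] ++ vars b.
Proof. by elim: s => //= a s ->; rewrite catA. Qed.

(** A single IL-sequence that serves every super-intuitionistic logic. *)
Definition joint_refutation (n : nat) : seq (fm V) :=
  [:: foldr (@Imp V) Bot (mkseq (fun i => Var (v i)) n)].

Lemma joint_refutation_in n a : a \in joint_refutation n -> Fm_in v n a.
Proof.
rewrite inE => /eqP -> y; rewrite vars_foldr_Imp cats0.
have -> : [seq vars b | b <- mkseq (fun i => Var (v i)) n] =
          [seq [:: z] | z <- mkseq v n] by rewrite -!map_comp.
by rewrite flatten_seq1.
Qed.

Lemma inst_joint_refutation (v_inj : injective v) n al :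
  size al = n -> inst v (joint_refutation n) al = [:: foldr (@Imp V) Bot al].
Proof.
move=> <-; rewrite /inst /= subst_foldr_Imp -map_comp; congr [:: foldr _ _ _].
apply: (@eq_from_nth _ Bot) => [|i]; rewrite size_map size_iota // => i_al.
rewrite (nth_map 0) ?size_iota //= nth_iota // add0n.
rewrite -[in index _ _](nth_mkseq (v 0) v i_al) index_uniq ?size_mkseq //.
  exact: set_nth_default.
exact: mkseq_uniq.
Qed.

End Substitution.

Section SuperIntuitionistic.
Variables (V : eqType) (v : nat -> V) (v_inj : injective v) (x : V).
Variables (L : set (fm V)) (L_si : super_intuitionistic L).

Let L_IPC : @IPC V `<=` L. Proof. by case: L_si. Qed.

Lemma derivable_set0 a : derivable L set0 a -> L a.
Proof.
case: L_si => _ _ L_mp.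
by elim=> // [b c _ Lbc _ Lb]; apply: L_mp Lbc Lb.
Qed.

(** The theorems of L are closed under all the rules generating [KC], so the
    single axiom suffices; hypotheses are then handled by modus ponens alone. *)
Lemma extends_KC_wem :
  extends (derivable L) (derivable (KC x)) <-> derivable L set0 (wem x).
Proof.
split=> [ext | /derivable_set0 Lwem G a]; first exact/ext/derivable_ax/KC_wem.
case: L_si => _ L_subst L_mp.
have KC_L b : KC x b -> L b.
  by elim=> // {b} [s b _ /L_subst | b c _ Lbc _ /(L_mp _ _ Lbc)].
elim=> {a} [a /KC_L | a | a b _ IHab _ IHa].
- exact: derivable_ax.
- exact: derivable_hyp.
- exact: derivable_mp IHab IHa.
Qed.

Lemma joint_refutation_IL :
  elementary_IL_sequence v (derivable L) (joint_refutation v).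
Proof.
move=> n _; split=> // [a|G al]; first exact: joint_refutation_in.
rewrite inst_joint_refutation ?size_tuple // inconsistentE // deduction //.
by split=> [Gal a /=| ]; [rewrite inE => /eqP -> | apply; exact: mem_head].
Qed.

(** As [joint_refutation n] has one member b, its second iterate is the single
    formula b -> Bot, and the WEML reduces to cases on ~ b and ~ ~ b. *)
Lemma KC_has_WEML : derivable L set0 (wem x) -> has_WEML v (derivable L).
Proof.
move=> /derivable_set0 Lwem.
exists (joint_refutation v); first exact: joint_refutation_IL.
move=> n n_gt0 G al phi.
rewrite /PsiPsi inst_inst => [|a /joint_refutation_in //].
rewrite !inst_joint_refutation ?size_tuple //=.
set b := foldr _ _ _ => Gb Gnb.
have wem_b : derivable L G (Or (Neg b) (Neg (Neg b))).
  by case: L_si => _ /(_ (fun=> b) _ Lwem) + _; apply: derivable_ax.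
(* The case b -> Bot of the WEML is ~ b, and the case b is ~ ~ b. *)
apply: (derivable_orE L_IPC wem_b).
- apply: derivable_cut Gnb => a [Ga|]; first by apply: derivable_hyp; left.
  rewrite /= inE => /eqP ->; apply/derivable_Neg => //.
  by apply: derivable_hyp; right; exact: mem_head.
- apply: derivable_cut Gb => a [Ga|]; first by apply: derivable_hyp; left.
  rewrite /= inE => /eqP ->; apply: foldr_Imp_Bot_regular => //.
  by apply: derivable_hyp; right; exact: mem_head.
Qed.

Section ILSequence.
Variable Psi : nat -> seq (fm V).
Hypothesis Psi_IL : elementary_IL_sequence v (derivable L) Psi.

Lemma IL_inconsistent n (al : n.-tuple (fm V)) G : 0 < n ->
  [set` inst v (Psi n) al] `<=` G -> derivable L (G `|` [set` al]) Bot.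
Proof.
move=> /Psi_IL[_ _ IL] sPsiG; apply/inconsistentE => //; apply/IL => a /sPsiG.
exact: derivable_hyp.
Qed.

Lemma IL1_Neg (a : fm V) :
  derivable L [set` inst v (Psi 1) [tuple a]] (Neg a).
Proof. by apply/derivable_Neg/deduction1/IL_inconsistent. Qed.

Lemma Neg_IL1 (a b : fm V) G : derivable L G (Neg a) ->
  b \in inst v (Psi 1) [tuple a] -> derivable L G b.
Proof.
move=> Gna; have [_ _ IL] := Psi_IL (ltn0Sn 0); apply IL.
by apply/inconsistentE => //; apply/deduction1/derivable_Neg.
Qed.

(** At the tuple (x), the two premises of the WEML hold because Psi_1(x) proves
    ~ x and, with m = #|Psi_1|, Psi_m(Psi_1(x)) proves ~ ~ x. *)
Lemma WEML_derives_wem :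
  (forall (G : set (fm V)) (al : 1.-tuple (fm V)) (phi : fm V),
     derivable L (G `|` [set` inst v (Psi 1) al]) phi ->
     derivable L (G `|` [set` inst v (PsiPsi v Psi 1) al]) phi ->
     derivable L G phi) ->
  derivable L set0 (wem x).
Proof.
set s := inst v (Psi 1) [tuple Var x].
have s_wem G : [set` s] `<=` G -> derivable L G (wem x).
  move=> sG; apply: derivable_mp (derivable_sub sG (IL1_Neg _)).
  exact/derivable_IPC/IPC_orl.
have [Psi1_0 _ | m_gt0] := posnP (size (Psi 1)).
  (* With no members, Psi 1 proves ~ x from nothing, whatever Psi 0 is. *)
  by apply: s_wem; rewrite /s (size0nil Psi1_0).
move=> /(_ set0 [tuple Var x]); apply; first by apply: s_wem => a; right.
rewrite /PsiPsi inst_inst; last by case: (Psi_IL m_gt0).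
rewrite -/s; set H := _ `|` _.
have size_s : size s == size (Psi 1) by rewrite size_map.
have H_s : derivable L (H `|` [set` s]) Bot.
  by apply: (@IL_inconsistent _ (Tuple size_s)) => // a; right.
apply: (@derivable_mp _ _ _ (Neg (Neg (Var x)))).
  exact/derivable_IPC/IPC_orr.
apply/derivable_Neg/deduction1 => //.
apply: derivable_cut H_s => a [Ha | sa]; first by apply: derivable_hyp; left.
by apply: Neg_IL1 sa; apply: derivable_hyp; right; exact: mem_head.
Qed.

End ILSequence.

End SuperIntuitionistic.

Theorem corollary8p6 (V : eqType) (v : nat -> V) (v_inj : injective v)
    (x : V) (L : set (fm V)) (L_si : super_intuitionistic L) :
  (has_WEML v (derivable L) <-> extends (derivable L) (derivable (KC x))) /\
  (extends (derivable L) (derivable (KC x)) <->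
     derivable L set0 (wem x)).
Proof.
have KC_wem_iff := extends_KC_wem x L_si.
split=> //; rewrite KC_wem_iff; split; last exact: KC_has_WEML.
by case=> Psi Psi_IL /(_ 1 (ltn0Sn 0)); exact: WEML_derives_wem Psi_IL.
Qed.
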